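(* Assume condition (H). Then the convex quadrangle inequality $$d_{i,l}+d_{j,k}\le d_{i,k}+d_{j,l}$$ holds for all $i,j,k,l\in\mathbb{N}\cup\{-1\}$ with $i\le j\le k\le l$. Moreover, for all $m,n\in\mathbb{N}$ with $m\le n$, the transport plan produced by the Inside-Out procedure for $(\pi^m,\pi^n)$ is an optimal solution of the minimization problem defining $d_{m,n}$.
   Context: Let $\mathbb{N}=\{0,1,2,\dots\}$. Fix a sequence $(\pi^n)_{n\in\mathbb{N}}$ where each $\pi^n=(\pi^n_i)_{i\in\mathbb{N}}$ is a probability distribution on $\mathbb{N}$ with support contained in $\{0,\dots,n\}$, and $\pi^n\ne\pi^m$ for $m\ne n$. Define reals $d_{m,n}$ for $m,n\in\mathbb{N}\cup\{-1\}$ recursively as follows: $d_{-1,-1}=0$, $d_{-1,j}=d_{j,-1}=1$ for $j\in\mathbb{N}$, and for $m,n\in\mathbb{N}$, $$d_{m,n}=\min_{z\in\mathcal{F}_{m,n}}\sum_{i=0}^m\sum_{j=0}^n z_{i,j}\,d_{i-1,j-1},$$ where $\mathcal{F}_{m,n}$ is the set of transport plans from $\pi^m$ to $\pi^n$, i.e. arrays $z=(z_{i,j})_{0\le i\le m,\,0\le j\le n}$ with $z_{i,j}\ge0$, $\sum_{j=0}^n z_{i,j}=\pi^m_i$ for all $i\le m$, and $\sum_{i=0}^m z_{i,j}=\pi^n_j$ for all $j\le n$. Condition (H) means: for every $n\ge1$, $\pi^n_n>0$ and $0\le\pi^n_i\le\pi^{n-1}_i$ for all $i<n$. Inside-Out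 procedure (input $\pi^m,\pi^n$ with $m\le n$): (1) for each $i=0,\dots,m$ set $z_{i,i}=\pi^n_i$ and $z_{j,i}=0$ for $j\ne i$, and compute the residual supply $\sigma_i=\pi^m_i-\pi^n_i$; (2) the remaining demands are $\pi^n_j$ at the nodes $j=m+1,\dots,n$; process the supply nodes in the order $i=m,m-1,\dots,0$, and use $\sigma_i$ to fill the still-unmet demands at nodes $j>m$ in increasing order of $j$ (starting at the first node whose demand is not yet completely met, which may have been partially filled by the previous supply node), setting $z_{i,j}$ equal to the amount sent from $i$ to $j$, until $\sigma_i$ is depleted; all other entries of $z$ are $0$. *)

(* Defs.v *)
From HB Require Import structures.
From mathcomp Require Import all_boot all_order all_algebra.
From mathcomp Require Import boolp classical_sets reals.
Set Implicit Arguments. Unset Strict Implicit. Unset Printing Implicit Defensive.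
Import Order.TTheory GRing.Theory Num.Theory.
Local Open Scope ring_scope.
Local Open Scope classical_set_scope.

Section Defs.
Variable R : realType.

(* pi n i = pi^n_i *)
Implicit Type pi : nat -> nat -> R.

Definition is_prob_seq pi : Prop :=
  forall n, [/\ (forall i, 0 <= pi n i),
               (forall i, (n < i)%N -> pi n i = 0) &
               \sum_(i < n.+1) pi n i = 1].

Definition pairwise_distinct pi : Prop :=
  forall m n, m <> n -> pi m <> pi n.

Definition condH pi : Prop :=
  forall n, (1 <= n)%N ->
    0 < pi n n /\ (forall i, (i < n)%N -> 0 <= pi n i <= pi n.-1 i).

Definition is_plan pi (m n : nat) (z : nat -> nat -> R) : Prop :=
  [/\ (forall i j, (i <= m)%N -> (j <= n)%N -> 0 <= z i j),
      (forall i, (i <= m)%N -> \sum_(j < n.+1) z i j = pi m i) &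
      (forall j, (j <= n)%N -> \sum_(i < m.+1) z i j = pi n j)].

(* cost of a plan w.r.t. a table T, where T i j stands for d_{i-1,j-1} *)
Definition cost (T : nat -> nat -> R) (m n : nat) (z : nat -> nat -> R) : R :=
  \sum_(i < m.+1) \sum_(j < n.+1) z i j * T i j.

(* Shifted table: Dtab k i j = D i j = d_{i-1,j-1} for i <= k. *)
Fixpoint Dtab pi (k : nat) : nat -> nat -> R :=
  match k with
  | 0 => fun _ j => if j == 0%N then 0 else 1
  | k'.+1 =>
      let T := Dtab pi k' in
      fun i j =>
        if (i <= k')%N then T i j
        else match j with
             | 0 => 1
             | n'.+1 => inf [set c | exists z, is_plan pi k' n' z /\ c = cost T k' n' z]
             end
  end.

(* D i j = d_{i-1,j-1} *)
Definition D pi (i j : nat) : R := Dtab pi i i j.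

(* d_{i,j} for i, j in N u {-1} (given as integers >= -1) *)
Definition d pi (i j : int) : R := D pi (absz (i + 1)) (absz (j + 1)).

(* Send supply s to demand nodes js in order; at node j send min(s, remaining demand).
   Returns (amounts sent to each node, updated remaining demands). *)
Fixpoint fill (s : R) (rem : nat -> R) (js : seq nat) : (nat -> R) * (nat -> R) :=
  match js with
  | [::] => (fun _ => 0, rem)
  | j :: js' =>
      let a := Num.min s (rem j) in
      let rem1 := fun k => if k == j then rem j - a else rem k in
      let res := fill (s - a) rem1 js' in
      (fun k => if k == j then a else res.1 k, res.2)
  end.

Fixpoint outer (sigma : nat -> R) (js : seq nat) (rem : nat -> R) (iis : seq nat)
  : nat -> nat -> R :=
  match iis with
  | [::] => fun _ _ => 0
  | i :: iis' =>
      let res := fill (sigma i) rem js in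
      let z' := outer sigma js res.2 iis' in
      fun i' j => if i' == i then res.1 j else z' i' j
  end.

Definition inside_out pi (m n : nat) : nat -> nat -> R :=
  let sigma := fun i => pi m i - pi n i in
  let js := iota m.+1 (n - m) in
  let off := outer sigma js (fun j => pi n j) (rev (iota 0 m.+1)) in
  fun i j =>
    if (i <= m)%N && (j <= n)%N then
      if (j <= m)%N then (if i == j then pi n i else 0) else off i j
    else 0.

End Defs.

(* Main.v *)
Require Import Defs.
From HB Require Import structures.
From mathcomp Require Import all_boot all_order all_algebra.
From mathcomp Require Import boolp classical_sets reals.
From mathcomp Require Import zify lra ring.
Set Implicit Arguments. Unset Strict Implicit. Unset Printing Implicit Defensive.
Import Order.TTheory GRing.Theory Num.Theory.
Local Open Scope ring_scope.

(* Write c for the table D restricted to the indices 0..L, and suppose that c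
   satisfies the quadrangle inequality, vanishes on the diagonal, and satisfies
   the triangle inequality through L.  Summation by parts writes the cost of a
   plan that never moves mass downwards as a term depending only on the source
   marginal, plus a combination of the masses G(a,b) sent from [a,L] to [a,b],
   with weights w(a,b), the mixed second differences of c, which are <= 0 by the
   quadrangle inequality.  For any plan from mu to nu,
   G(a,b) <= min(mu[a,L], nu[a,b]), and the Inside-Out plan attains all these
   bounds at once; downward moves are no cheaper by the triangle inequality.
   Hence Inside-Out is optimal and the next row and column of the table have a
   closed form (nested_value).  In this form the quadrangle inequality at the
   next level reduces, for each (a,b), to the supermodularity of min together
   with the monotonicity that (H) gives to tails and truncated masses. *)

(** * Greedy filling of demands *)

Lemma fill_notin (R : realType) (s : R) rem js j :
  j \notin js -> (fill s rem js).1 j = 0.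
Proof.
elim: js s rem => [//|x js IH] s rem /=.
by rewrite inE negb_or => /andP[/negPf -> /IH].
Qed.

Lemma fill_rem (R : realType) (s : R) rem js j :
  uniq js -> (fill s rem js).2 j = rem j - (fill s rem js).1 j.
Proof.
elim: js s rem => [|x js IH] s rem /=; first by rewrite subr0.
move=> /andP[xjs /IH ->]; case: eqP => [->|//].
by rewrite fill_notin // subr0.
Qed.

Lemma fill_bounds (R : realType) (s : R) rem js j :
  0 <= s -> (forall k, 0 <= rem k) -> 0 <= (fill s rem js).1 j <= rem j.
Proof.
elim: js s rem => [|x js IH] s rem s0 rem0 /=; first by rewrite lexx rem0.
have a1 : Num.min s (rem x) <= s by rewrite ge_min lexx.
have a2 : Num.min s (rem x) <= rem x by rewrite ge_min lexx orbT.
case: eqP => [->|/eqP jx]; first by rewrite a2 le_min s0 rem0.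
have /= := IH (s - Num.min s (rem x))
  (fun k => if k == x then rem x - Num.min s (rem x) else rem k).
rewrite (negPf jx); apply; first by rewrite subr_ge0.
by move=> k; case: eqP => _; rewrite ?subr_ge0.
Qed.

(** Greedy filling in order serves every prefix of the nodes as far as the supply allows. The end
    [b] is free because the prefix sums determine the single amounts, and demand vanishing past the
    list lets [b] overshoot it. The induction rests on min(s,r) + min(s - min(s,r), S) = min(s, r +
    S) for s, r, S >= 0. *)
Lemma fill_sum (R : realType) (s : R) rem a k b :
  0 <= s -> (forall j, 0 <= rem j) -> (forall j, (a + k <= j)%N -> rem j = 0) ->
  \sum_(a <= j < b) (fill s rem (iota a k)).1 j = Num.min s (\sum_(a <= j < b) rem j).
Proof.
elim: k a s rem => [|k IH] a s rem s0 rem0 remk.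
  rewrite addn0 in remk.
  by rewrite /= !big_nat big1 // big1 ?min_r // => j /andP[aj _]; exact: remk.
case: (ltnP a b) => ab; last by rewrite !big_geq ?min_r.
rewrite !(big_ltn ab) /= eqxx; set x := Num.min s (rem a).
have a1 : x <= s by rewrite ge_min lexx.
have a2 : x <= rem a by rewrite ge_min lexx orbT.
have rem1E j : (a < j)%N -> (if j == a then rem a - x else rem j) = rem j.
  by move=> aj; rewrite gtn_eqF.
under eq_big_nat => j /andP[aj _] do rewrite (gtn_eqF aj).
rewrite IH.
- rewrite (eq_big_nat _ _ (F2 := rem)); last by move=> j /andP[aj _]; exact: rem1E.
  have S0 : 0 <= \sum_(a.+1 <= j < b) rem j by apply: sumr_ge0.
  move: (rem0 a) S0; rewrite /x; set S := \sum_(_ <= _ < _) _ => r0 S0.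
  by case: (leP s (rem a)) => h; case: leP => h1; case: leP => h2; lra.
- by rewrite subr_ge0.
- by move=> j; case: eqP => _ //; rewrite subr_ge0.
- by move=> j aj; rewrite rem1E ?remk //; lia.
Qed.

Lemma rev_iota0S k : rev (iota 0 k.+1) = k :: rev (iota 0 k).
Proof. by rewrite -addn1 iotaD rev_cat add0n. Qed.

Lemma outer_row_notin (R : realType) (sigma : nat -> R) js rem iis i j :
  i \notin iis -> outer sigma js rem iis i j = 0.
Proof.
elim: iis rem => [//|x iis IH] rem /=.
by rewrite inE negb_or => /andP[/negPf -> /IH].
Qed.

Lemma outer_col_notin (R : realType) (sigma : nat -> R) js rem iis i j :
  j \notin js -> outer sigma js rem iis i j = 0.
Proof.
elim: iis rem => [//|x iis IH] rem /= jjs.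
by case: eqP => _; [exact: fill_notin|exact: IH].
Qed.

Lemma outer_ge0 (R : realType) (sigma : nat -> R) js rem iis i j :
  uniq js -> (forall p, p \in iis -> 0 <= sigma p) -> (forall k, 0 <= rem k) ->
  0 <= outer sigma js rem iis i j.
Proof.
move=> ujs; elim: iis rem => [//|x iis IH] rem /= sigma0 rem0.
have s0 := sigma0 x (mem_head _ _).
case: eqP => _; first by have /andP[] := fill_bounds js j s0 rem0.
apply: IH => [p pis|k]; first by apply: sigma0; rewrite inE pis orbT.
by rewrite fill_rem // subr_ge0; have /andP[] := fill_bounds js k s0 rem0.
Qed.

(* The anti-monotone coupling maximizes the mass sent from the last sources to
   the first targets, and this determines it. *)
Lemma outer_sum (R : realType) (sigma : nat -> R) rem s r k a b :
  (forall p, (p < k)%N -> 0 <= sigma p) -> (forall j, 0 <= rem j) ->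
  (forall j, (s + r <= j)%N -> rem j = 0) ->
  \sum_(a <= p < k) \sum_(s <= j < b) outer sigma (iota s r) rem (rev (iota 0 k)) p j
  = Num.min (\sum_(a <= p < k) sigma p) (\sum_(s <= j < b) rem j).
Proof.
elim: k rem => [|k IH] rem sigma0 rem0 remr.
  by rewrite !(big_geq (leq0n a)) min_l ?sumr_ge0.
case: (ltnP k a) => ka; first by rewrite !(big_geq ka) min_l ?sumr_ge0.
have s0 := sigma0 k (ltnSn k).
(* Source [k] is served first and the others share the demand it leaves. With A the supply of the
   others and T the total demand, min(A, T - min(s,T)) + min(s,T) = min(A + s, T). *)
rewrite !big_nat_recr //= rev_iota0S /= eqxx fill_sum //.
have sig p : (p < k)%N -> 0 <= sigma p by move=> pk; apply: sigma0; lia.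
have fb j := fill_bounds (iota s r) j s0 rem0.
rewrite (eq_big_nat _ _ (F2 := fun p => \sum_(s <= j < b)
  outer sigma (iota s r) (fill (sigma k) rem (iota s r)).2 (rev (iota 0 k)) p j));
  last by move=> p /andP[_ pk]; apply: eq_bigr => j _; rewrite (ltn_eqF pk).
rewrite IH //.
- under [X in Num.min _ X + _]eq_bigr => j _ do rewrite fill_rem ?iota_uniq //.
  rewrite sumrB fill_sum //.
  have : 0 <= \sum_(a <= p < k) sigma p.
    by rewrite big_nat; apply: sumr_ge0 => p /andP[_ /sig].
  have : 0 <= \sum_(s <= j < b) rem j by apply: sumr_ge0.
  set S := \sum_(a <= _ < _) _; set T := \sum_(s <= _ < _) _ => T0 S0.
  by case: (leP (sigma k) T) => h1; case: leP => h2; case: leP => h3; lra.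
- by move=> j; rewrite fill_rem ?iota_uniq // subr_ge0; case/andP: (fb j).
- move=> j jr; rewrite fill_rem ?iota_uniq // remr // fill_notin ?subr0 //.
  by rewrite mem_iota; lia.
Qed.

(** * Summation by parts and the lower bound for couplings *)

Definition coupling (R : realType) (M : nat) (mu nu : nat -> R) (z : nat -> nat -> R) :=
  [/\ forall p q, 0 <= z p q,
      forall p, (p < M)%N -> \sum_(0 <= q < M) z p q = mu p &
      forall q, (q < M)%N -> \sum_(0 <= p < M) z p q = nu q].

Definition total_cost (R : realType) (M : nat) (c z : nat -> nat -> R) : R :=
  \sum_(0 <= p < M) \sum_(0 <= q < M) z p q * c p q.

(** A zero row placed before row 0 makes the differences add up to [c] itself, without a boundary
    term. *)
Definition row_diff (R : realType) (c : nat -> nat -> R) (a x : nat) : R :=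
  c a x - (if a is a'.+1 then c a' x else 0).

Definition mixed_diff (R : realType) (c : nat -> nat -> R) (a b : nat) : R :=
  row_diff c a b - row_diff c a b.+1.

(** The first sum prices all mass as if it were sent to [L]; the weights then correct for the mass
    from [a,L] that stops in [a,b], taken at its largest possible value. *)
Definition nested_value (R : realType) (c : nat -> nat -> R) (L : nat)
    (mu nu : nat -> R) : R :=
  \sum_(0 <= p < L.+1) mu p * c p L +
  \sum_(0 <= a < L.+1) \sum_(a <= b < L) mixed_diff c a b *
    Num.min (\sum_(a <= p < L.+1) mu p) (\sum_(a <= q < b.+1) nu q).

(* The downward entries of [c] are replaced by the lower bound given by the
   triangle inequality through [L]. *)
Definition forward_cost (R : realType) (c : nat -> nat -> R) (L p q : nat) : R :=
  if (p <= q)%N then c p q else c p L - c q L.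

Lemma sum_leq_indic (R : realType) (f : nat -> R) k M :
  (k < M)%N -> \sum_(0 <= a < M) (a <= k)%N%:R * f a = \sum_(0 <= a < k.+1) f a.
Proof.
move=> kM; rewrite (@big_cat_nat _ _ _ k.+1) //= [X in _ + X]big1_seq ?addr0.
  by apply: eq_big_nat => a /andP[_ ak]; rewrite (_ : (a <= k)%N) ?mul1r //; lia.
by move=> a; rewrite mem_index_iota => /andP[_ ak]; rewrite leqNgt (_ : (k < a)%N) ?mul0r //; lia.
Qed.

Lemma sum_geq_indic (R : realType) (f : nat -> R) s k M :
  (s <= k)%N -> \sum_(s <= a < M) (k <= a)%N%:R * f a = \sum_(k <= a < M) f a.
Proof.
move=> sk; case: (leqP k M) => kM.
  rewrite (@big_cat_nat _ _ _ k) //= big1_seq ?add0r.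
    by apply: eq_big_nat => a /andP[ka _]; rewrite ka mul1r.
  by move=> a; rewrite mem_index_iota => /andP[_ ak]; rewrite leqNgt (_ : (a < k)%N) ?mul0r //; lia.
rewrite [RHS]big_geq; last exact: ltnW.
rewrite big1_seq // => a; rewrite mem_index_iota => /andP[_ ak].
by rewrite leqNgt (_ : (a < k)%N) ?mul0r //; lia.
Qed.

Lemma sum_row_diff (R : realType) (c : nat -> nat -> R) k x :
  \sum_(0 <= a < k.+1) row_diff c a x = c k x.
Proof.
elim: k => [|k IH]; first by rewrite big_nat1 /row_diff subr0.
by rewrite big_nat_recr //= IH /row_diff addrC subrK.
Qed.

Lemma sum_mixed_diff (R : realType) (c : nat -> nat -> R) a q L :
  (q <= L)%N ->
  \sum_(q <= b < L) mixed_diff c a b = row_diff c a q - row_diff c a L.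
Proof.
move=> qL; rewrite -opprB -(telescope_sumr (row_diff c a) qL) -sumrN.
by apply: eq_bigr => b _; rewrite opprB.
Qed.

(** Summing the weights over b >= q and then over a <= r, where r = min(p,q), telescopes to c(r,q) -
    c(r,L). For p <= q this leaves c(p,q); for q < p it leaves c(p,L) - c(q,L), since c(q,q) = 0. *)
Lemma forward_costE (R : realType) (c : nat -> nat -> R) L p q :
  (forall r, (r <= L)%N -> c r r = 0) -> (p <= L)%N -> (q <= L)%N ->
  forward_cost c L p q = c p L + \sum_(0 <= a < L.+1) \sum_(a <= b < L)
    ((a <= p) && (a <= q) && (q <= b))%N%:R * mixed_diff c a b.
Proof.
move=> c0 pL qL.
rewrite (eq_big_nat _ _ (F2 := fun a => (a <= minn p q)%N%:R *
   (row_diff c a q - row_diff c a L))); last first.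
  move=> a _; rewrite leq_min; case: (a <= p)%N => /=; last first.
    by rewrite mul0r big1 // => b _; rewrite mul0r.
  case: (leqP a q) => aq /=; last by rewrite mul0r big1 // => b _; rewrite mul0r.
  by rewrite mul1r sum_geq_indic // sum_mixed_diff.
rewrite sum_leq_indic; last by rewrite ltnS geq_min pL.
rewrite sumrB !sum_row_diff /forward_cost.
by case: leqP => pq; [lra | rewrite c0 // sub0r].
Qed.

Lemma total_forward_cost (R : realType) (c z : nat -> nat -> R) L mu :
  (forall r, (r <= L)%N -> c r r = 0) ->
  (forall p, (p <= L)%N -> \sum_(0 <= q < L.+1) z p q = mu p) ->
  total_cost L.+1 (forward_cost c L) z = \sum_(0 <= p < L.+1) mu p * c p L +
    \sum_(0 <= a < L.+1) \sum_(a <= b < L) mixed_diff c a b *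
      \sum_(a <= p < L.+1) \sum_(a <= q < b.+1) z p q.
Proof.
move=> c0 zmu; rewrite /total_cost.
rewrite (eq_big_nat _ _ (F2 := fun p => mu p * c p L +
  \sum_(0 <= a < L.+1) \sum_(a <= b < L) \sum_(0 <= q < L.+1)
    z p q * (((a <= p) && (a <= q) && (q <= b))%N%:R * mixed_diff c a b))); last first.
  move=> p /andP[_ pL]; rewrite -(zmu p) // mulr_suml.
  rewrite (eq_big_nat _ _ (F2 := fun q => z p q * c p L +
    \sum_(0 <= a < L.+1) \sum_(a <= b < L)
     z p q * (((a <= p) && (a <= q) && (q <= b))%N%:R * mixed_diff c a b))); last first.
    move=> q /andP[_ qL]; rewrite forward_costE // mulrDr mulr_sumr.
    by congr (_ + _); apply: eq_bigr => a _; rewrite mulr_sumr.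
  rewrite big_split /=; congr (_ + _); rewrite exchange_big_nat /=.
  by apply: eq_bigr => a _; rewrite exchange_big_nat.
rewrite big_split /=; congr (_ + _); rewrite exchange_big_nat /=.
apply: eq_bigr => a _; rewrite exchange_big_nat /=.
rewrite big_nat [RHS]big_nat; apply: eq_bigr => b /andP[ab bL].
(* The restricted ranges of [p] and [q] are traded for indicators, to be matched with the product of
   conditions on the other side. *)
rewrite -(@sum_geq_indic _ _ 0%N a) // mulr_sumr; apply: eq_bigr => p _.
rewrite -(@sum_geq_indic _ (z p) 0%N a) //.
rewrite -(@sum_leq_indic _ (fun q => (a <= q)%N%:R * z p q) b L.+1); last lia.
rewrite !mulr_sumr; apply: eq_bigr => q _.
by case: (a <= p)%N; case: (a <= q)%N; case: (q <= b)%N => /=; ring.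
Qed.

(** For a > 0 this is the quadrangle inequality on two adjacent rows and columns. For a = 0 the
    preceding row is the zero row, and the sign comes from monotonicity of row 0. *)
Lemma mixed_diff_le0 (R : realType) (c : nat -> nat -> R) L a b :
  (forall i j k l, (i <= j <= k)%N -> (k <= l <= L)%N ->
     c i l + c j k <= c i k + c j l) ->
  (forall x, (x < L)%N -> c 0%N x <= c 0%N x.+1) ->
  (a <= b)%N -> (b < L)%N -> mixed_diff c a b <= 0.
Proof.
move=> Q c0 ab bL; rewrite /mixed_diff /row_diff; case: a ab => [|a] ab.
  by have := c0 b bL; lra.
have := Q a a.+1 b b.+1; rewrite ab leqnSn leqnSn bL /= => /(_ isT isT); lra.
Qed.

Lemma nested_value_le (R : realType) (c z : nat -> nat -> R) L mu nu :
  (forall i j k l, (i <= j <= k)%N -> (k <= l <= L)%N ->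
     c i l + c j k <= c i k + c j l) ->
  (forall x, (x < L)%N -> c 0%N x <= c 0%N x.+1) ->
  (forall r, (r <= L)%N -> c r r = 0) ->
  (forall p q, (q < p <= L)%N -> c p L - c q L <= c p q) ->
  coupling L.+1 mu nu z ->
  nested_value c L mu nu <= total_cost L.+1 c z.
Proof.
move=> Q c0 cZ T [z0 zmu znu].
apply: (@le_trans _ _ (total_cost L.+1 (forward_cost c L) z)).
  rewrite (@total_forward_cost _ _ _ _ mu) //.
  rewrite lerD2l; apply: ler_sum => a _; rewrite big_nat [leRHS]big_nat.
  apply: ler_sum => b /andP[ab bL]; apply: ler_wnM2l.
    exact: (@mixed_diff_le0 _ _ L).
  (* The weights being nonpositive, upper bounds on the masses are wanted: row sums give the tail of
     [mu], column sums the truncated mass of [nu]. *)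
  rewrite le_min; apply/andP; split.
    rewrite big_nat [leRHS]big_nat; apply: ler_sum => p /andP[ap pL].
    rewrite -(zmu p) // -(@sum_geq_indic _ _ 0 a) // -(@sum_leq_indic _ _ b L.+1); last lia.
    apply: ler_sum => q _; have := z0 p q.
    by case: (q <= b)%N; case: (a <= q)%N => /=; rewrite ?mul0r ?mul1r ?mulr0.
  rewrite exchange_big_nat /= big_nat [leRHS]big_nat.
  apply: ler_sum => q /andP[aq qb]; rewrite -(znu q); last lia.
  rewrite -(@sum_geq_indic _ _ 0 a) //; apply: ler_sum => p _; have := z0 p q.
  by case: (a <= p)%N => /=; rewrite ?mul0r ?mul1r.
rewrite /total_cost; apply: ler_sum_nat => p /andP[_ pL].
apply: ler_sum_nat => q /andP[_ qL]; apply: ler_wpM2l => //.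
by rewrite /forward_cost; case: leqP => // qp; apply: T; rewrite qp.
Qed.

(** * Tails and truncated masses under (H) *)

Lemma sum_trunc (R : realType) (f : nat -> R) a k M :
  (k <= M)%N -> (forall i, (k <= i)%N -> f i = 0) ->
  \sum_(a <= i < M) f i = \sum_(a <= i < k) f i.
Proof.
move=> kM f0; case: (leqP a k) => ak.
  rewrite (@big_cat_nat _ _ _ k) //= [X in _ + X]big1_seq ?addr0 // => i.
  by rewrite mem_index_iota => /andP[_ /andP[/f0]].
rewrite [RHS]big_geq ?big1_seq //; last exact: ltnW.
by move=> i; rewrite mem_index_iota => /andP[_ ai]; apply: f0; lia.
Qed.

Lemma sum_prob (R : realType) (pi : nat -> nat -> R) n M :
  is_prob_seq pi -> (n < M)%N -> \sum_(0 <= p < M) pi n p = 1.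
Proof.
move=> /(_ n)[_ s1 <-] nM.
by rewrite (sum_trunc 0 nM s1) big_mkord.
Qed.

Lemma condH_anti (R : realType) (pi : nat -> nat -> R) q k l :
  condH pi -> (q <= k <= l)%N -> pi l q <= pi k q.
Proof.
move=> H; elim: l => [|l IH] /andP[qk kl]; first by have -> : k = 0%N by lia.
move: kl; rewrite leq_eqVlt => /orP[/eqP->//|kl].
apply: le_trans (IH _); last by rewrite qk.
by have [_ /(_ q)] := H l.+1 isT; case/(_ _)/andP; first lia.
Qed.

(** For a <= m, (H) lowers every entry below [a] when passing from [m] to [n], and both total masses
    are 1, so the tail grows. For a > m the tail of [pi m] is zero. *)
Lemma tail_mono (R : realType) (pi : nat -> nat -> R) m n M a :
  is_prob_seq pi -> condH pi -> (m <= n)%N -> (n < M)%N ->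
  \sum_(a <= p < M) pi m p <= \sum_(a <= p < M) pi n p.
Proof.
move=> P H mn nM; have [m0 ms _] := P m; have [n0 _ _] := P n.
case: (leqP a m) => am; last first.
  by rewrite big_nat big1 ?sumr_ge0 // => p /andP[ap _]; apply: ms; lia.
have aM : (a <= M)%N by lia.
have := sum_prob P nM; rewrite -{1}(@sum_prob _ pi m M) //; last lia.
rewrite !(@big_cat_nat _ _ _ a 0%N M) //=.
have : \sum_(0 <= p < a) pi n p <= \sum_(0 <= p < a) pi m p.
  by apply: ler_sum_nat => p /andP[_ pa]; apply: condH_anti => //; lia.
lra.
Qed.

(** * Inequalities between nested values *)

Lemma nested_value0 (R : realType) (c : nat -> nat -> R) L (nu : nat -> R) :
  (forall q, 0 <= nu q) -> nested_value c L (fun=> 0) nu = 0.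
Proof.
move=> nu0; rewrite /nested_value !big1 ?addr0 // => i _; rewrite ?mul0r //.
by rewrite big1 // => b _; rewrite big1 // min_l ?mulr0 ?sumr_ge0.
Qed.

(** The sources are arbitrary measures so that the zero measure is allowed. The bound on the tails
    of [mu'] stands for j <= k. The terms that depend on the source alone cancel. *)
Lemma nested_value_quadrangle (R : realType) (pi c : nat -> nat -> R) L
    (mu mu' : nat -> R) k l :
  is_prob_seq pi -> condH pi ->
  (forall a b, (a <= b < L)%N -> mixed_diff c a b <= 0) ->
  (forall a, \sum_(a <= p < L.+1) mu p <= \sum_(a <= p < L.+1) mu' p) ->
  (forall a, \sum_(a <= p < L.+1) mu' p <= \sum_(a <= p < L.+1) pi k p) ->
  (k <= l <= L)%N ->
  nested_value c L mu (pi l) + nested_value c L mu' (pi k) <=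
  nested_value c L mu (pi k) + nested_value c L mu' (pi l).
Proof.
move=> P H W mumu' mu'k /andP[kl lL]; rewrite /nested_value.
rewrite addrACA [leRHS]addrACA lerD2l -!big_split /= big_nat [leRHS]big_nat.
apply: ler_sum => a _; rewrite -!big_split /= big_nat [leRHS]big_nat.
apply: ler_sum => b abL; rewrite -!mulrDr; apply: ler_wnM2l; first exact: W.
move: (mumu' a) (mu'k a) => A1 A2.
set A := \sum_(a <= _ < _) mu _ in A1 *; set A' := \sum_(a <= _ < _) mu' _ in A1 A2 *.
set Bk := \sum_(_ <= q < b.+1) pi k q; set Bl := \sum_(_ <= q < b.+1) pi l q.
(* For b <= k the truncated mass decreases with the target; for k < b it is
   the whole tail of pi k and does not constrain. *)
have [BB|BA] : Bl <= Bk \/ A' <= Bk.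
- case: (leqP b k) => bk; [left|right].
    by apply: ler_sum_nat => q qb; apply: condH_anti => //; lia.
  apply: (le_trans A2); rewrite (@sum_trunc _ _ a b.+1 L.+1) //; first lia.
  by move=> i bi; have [_ s _] := P k; apply: s; lia.
- by case: (leP A Bk) => ?; case: (leP A Bl) => ?; case: (leP A' Bk) => ?;
    case: (leP A' Bl) => ?; lra.
- by case: (leP A Bk) => ?; case: (leP A Bl) => ?; case: (leP A' Bk) => ?;
    case: (leP A' Bl) => ?; lra.
Qed.

(** Larger tails of the source enlarge every min, so the double sum with its nonpositive weights can
    only decrease. This serves the triangle inequality through the last column. *)
Lemma nested_value_leB (R : realType) (c : nat -> nat -> R) L (mu mu' nu : nat -> R) :
  (forall a b, (a <= b < L)%N -> mixed_diff c a b <= 0) ->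
  (forall a, \sum_(a <= p < L.+1) mu p <= \sum_(a <= p < L.+1) mu' p) ->
  nested_value c L mu' nu - nested_value c L mu nu <=
  \sum_(0 <= p < L.+1) mu' p * c p L - \sum_(0 <= p < L.+1) mu p * c p L.
Proof.
move=> W mumu'; rewrite /nested_value opprD addrACA gerDl subr_le0.
rewrite big_nat [leRHS]big_nat; apply: ler_sum => a _.
rewrite big_nat [leRHS]big_nat; apply: ler_sum => b abL.
apply: ler_wnM2l; first exact: W.
by rewrite le_min ge_min mumu' /= ge_min lexx orbT.
Qed.

Lemma nested_value_le_last (R : realType) (c : nat -> nat -> R) L (mu nu : nat -> R) :
  (forall a b, (a <= b < L)%N -> mixed_diff c a b <= 0) ->
  (forall p, 0 <= mu p) -> (forall p, 0 <= nu p) ->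
  nested_value c L mu nu <= \sum_(0 <= p < L.+1) mu p * c p L.
Proof.
move=> W mu0 nu0.
have := @nested_value_leB _ c L (fun=> 0) mu nu W; rewrite nested_value0 // subr0.
rewrite (_ : \sum_(0 <= p < L.+1) 0 * c p L = 0); last by rewrite big1 // => p _; rewrite mul0r.
by rewrite subr0; apply=> a; rewrite big1 // sumr_ge0.
Qed.

(** * The Inside-Out plan: feasibility, masses and cost *)

Lemma inside_outE (R : realType) (pi : nat -> nat -> R) m n p q :
  (m <= n)%N -> inside_out pi m n p q =
  if (q <= m)%N then (if p == q then pi n q else 0)
  else outer (fun i => pi m i - pi n i) (iota m.+1 (n - m)) (pi n)
         (rev (iota 0 m.+1)) p q.
Proof.
move=> mn; rewrite /inside_out; case: ifP => [/andP[pm qn]|].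
  by case: ifP => // _; case: eqP => // ->.
case: (leqP q m) => qm pq; last first.
  move/negbT: pq; rewrite negb_and -!ltnNge => /orP[mp|nq].
    by rewrite outer_row_notin // mem_rev mem_iota; lia.
  by rewrite outer_col_notin // mem_iota; lia.
by rewrite gtn_eqF //; lia.
Qed.

Section InsideOut.
Context (R : realType) (pi : nat -> nat -> R) (m n : nat).
Hypotheses (P : is_prob_seq pi) (H : condH pi) (mn : (m <= n)%N).

Let off := outer (fun i => pi m i - pi n i) (iota m.+1 (n - m)) (pi n)
         (rev (iota 0 m.+1)).

Let off_sum a b : \sum_(a <= p < m.+1) \sum_(m.+1 <= q < b) off p q =
  Num.min (\sum_(a <= p < m.+1) (pi m p - pi n p)) (\sum_(m.+1 <= q < b) pi n q).
Proof.
have [n0 ns _] := P n.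
apply: outer_sum => //.
  by move=> p pm; rewrite subr_ge0 condH_anti //; lia.
by move=> j nj; apply: ns; lia.
Qed.

Let off_row p q : (m < p)%N -> off p q = 0.
Proof. by move=> mp; rewrite /off outer_row_notin // mem_rev mem_iota; lia. Qed.

Lemma inside_out_row_gt p q : (m < p)%N -> inside_out pi m n p q = 0.
Proof.
move=> mp; rewrite inside_outE //; case: leqP => qm; last exact: off_row.
by rewrite gtn_eqF //; lia.
Qed.

Lemma inside_out_col_gt p q : (n < q)%N -> inside_out pi m n p q = 0.
Proof. by move=> nq; rewrite /inside_out (leqNgt q) nq andbF. Qed.

Lemma inside_out_below_diag p q : (q < p)%N -> inside_out pi m n p q = 0.
Proof.
move=> qp; rewrite inside_outE //; case: (leqP q m) => qm.
  by rewrite gtn_eqF.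
by apply: off_row; lia.
Qed.

Lemma inside_out_ge0 p q : 0 <= inside_out pi m n p q.
Proof.
have [n0 _ _] := P n.
rewrite inside_outE //; do 2?case: ifP => // _.
apply: outer_ge0 => //; first exact: iota_uniq.
move=> i; rewrite mem_rev mem_iota => im.
by rewrite subr_ge0 condH_anti //; lia.
Qed.

Let total_residual M : (n < M)%N ->
  \sum_(0 <= p < m.+1) (pi m p - pi n p) = \sum_(m.+1 <= q < M) pi n q.
Proof.
move=> nM; rewrite sumrB (@sum_prob _ pi m) //.
rewrite -(sum_prob P nM) (@big_cat_nat _ _ _ m.+1 0%N M) //=; last lia.
by rewrite addrAC subrr add0r.
Qed.

Lemma inside_out_coupling M : (n < M)%N ->
  coupling M (pi m) (pi n) (inside_out pi m n).
Proof.
move=> nM; have [n0 ns _] := P n; have [m0 ms _] := P m.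
have mM : (m < M)%N by lia.
split => [||q qM]; first exact: inside_out_ge0.
- move=> p pM; case: (leqP p m) => pm; last first.
    by rewrite ms // big1 // => q _; rewrite inside_out_row_gt.
  rewrite (@big_cat_nat _ _ _ m.+1) //=.
  rewrite (eq_big_nat _ _ (F2 := fun q => if q == p then pi n q else 0)); last first.
    by move=> q /andP[_ qm]; rewrite inside_outE // -ltnS qm eq_sym.
  rewrite -big_mkcond big_nat1_eq /= ltnS pm.
  rewrite (eq_big_nat _ _ (F2 := off p)); last first.
    by move=> q /andP[mq _]; rewrite inside_outE // leqNgt mq.
  have sig i : (i < m.+1)%N -> 0 <= pi m i - pi n i.
    by move=> im; rewrite subr_ge0 condH_anti //; lia.
  (* Every tail of the residual supply fits into the demand beyond [m], so the mins in [off_sum] are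
     supplies; subtracting the cases [p] and [p.+1] isolates row [p]. *)
  have tl a : \sum_(a <= i < m.+1) (pi m i - pi n i) <= \sum_(m.+1 <= q < M) pi n q.
    rewrite -total_residual //; case: (leqP a m.+1) => am.
      rewrite (@big_cat_nat _ _ _ a 0%N m.+1) //= lerDr big_nat.
      by apply: sumr_ge0 => i ia; apply: sig; lia.
    rewrite big_geq; last exact: ltnW.
    by rewrite big_nat; apply: sumr_ge0 => i ia; apply: sig; lia.
  have := off_sum p M; have := off_sum p.+1 M; rewrite !min_l //.
  rewrite [\sum_(p <= i < m.+1) \sum_(_ <= _ < _) _]big_ltn //.
  by rewrite [\sum_(p <= i < m.+1) (_ - _)]big_ltn // => -> /addIr ->; lra.
- case: (leqP q m) => qm.
    under eq_bigr => p _ do rewrite inside_outE // qm.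
    by rewrite -big_mkcond big_nat1_eq /= qM.
  rewrite (@sum_trunc _ _ 0 m.+1 M) //; last by move=> p mp; exact: inside_out_row_gt.
  under eq_bigr => p _ do rewrite inside_outE // (leqNgt q) qm /=.
  (* Dually, every prefix of the demand is covered by the total residual supply; subtracting the
     cases [q] and [q.+1] isolates column [q]. *)
  have tl b : (b <= M)%N -> \sum_(m.+1 <= q < b) pi n q <= \sum_(0 <= p < m.+1) (pi m p - pi n p).
    move=> bM; rewrite (total_residual nM); case: (leqP m.+1 b) => mb.
      by rewrite (@big_cat_nat _ _ _ b m.+1 M) //= lerDl sumr_ge0.
    by rewrite big_geq ?sumr_ge0 //; exact: ltnW.
  have := off_sum 0 q.+1; have := off_sum 0 q; rewrite !min_r ?tl //; last exact: ltnW.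
  under [X in _ -> X = _ -> _]eq_bigr => p _ do rewrite big_nat_recr //=.
  by rewrite big_split /= [X in _ -> _ = X -> _]big_nat_recr //= => -> /addrI ->.
Qed.

(** For b <= m the diagonal already meets all demand in [a,b], which (H) keeps below the supply. For
    a <= m < b, let X be the source tail, Y the target mass on [a,m] and Z that on [m+1,b]: the
    diagonal carries Y, the rest min(X - Y, Z), together min(X, Y + Z). *)
Lemma inside_out_mass M a b : (n < M)%N -> (a <= b < M)%N ->
  \sum_(a <= p < M) \sum_(a <= q < b.+1) inside_out pi m n p q =
  Num.min (\sum_(a <= p < M) pi m p) (\sum_(a <= q < b.+1) pi n q).
Proof.
move=> nM /andP[ab bM]; have [n0 ns _] := P n; have [m0 ms _] := P m.
have diag x : (x <= m.+1)%N -> (x <= M)%N ->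
    \sum_(a <= p < M) \sum_(a <= q < x) inside_out pi m n p q = \sum_(a <= q < x) pi n q.
  move=> xm xM; rewrite exchange_big_nat; apply: eq_big_nat => q /andP[aq qx] /=.
  have qm : (q <= m)%N by lia.
  under eq_bigr => p _ do rewrite inside_outE // qm.
  by rewrite -big_mkcond big_nat1_eq /= aq (leq_trans qx).
case: (leqP b m) => bm.
  rewrite diag // min_r // (@big_cat_nat _ _ _ b.+1 a M) //=; last lia.
  rewrite -[leLHS]addr0; apply: lerD; last exact: sumr_ge0.
  by apply: ler_sum_nat => q qb; apply: condH_anti => //; lia.
have mM : (m < M)%N by lia.
rewrite (@sum_trunc _ (pi m) a m.+1 M) //.
case: (leqP a m) => am; last first.
  rewrite (big_geq am) min_l ?sumr_ge0 // big_nat big1 // => p /andP[ap _].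
  by apply: big1 => q _; apply: inside_out_row_gt; lia.
have am1 : (a <= m.+1)%N by exact: ltnW.
have mb1 : (m.+1 <= b.+1)%N by exact: ltnW.
under eq_bigr => p _ do rewrite (@big_cat_nat _ _ _ m.+1 a b.+1) //=.
rewrite big_split /= diag //.
rewrite (@sum_trunc _ (fun p => \sum_(m.+1 <= q < b.+1) _) a m.+1 M) //; last first.
  by move=> p mp; apply: big1 => q _; exact: inside_out_row_gt.
under [X in _ + X]eq_bigr => p _ do under eq_big_nat => q /andP[mq _] do
  rewrite inside_outE // (leqNgt q) mq /=.
rewrite off_sum sumrB (@big_cat_nat _ _ _ m.+1 a b.+1) //=.
set X := \sum_(_ <= _ < _) pi m _; set Y := \sum_(_ <= _ < _) pi n _.
set Z := \sum_(_ <= _ < _) pi n _.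
by case: (leP (X - Y) Z) => ?; case: leP => ?; lra.
Qed.

Lemma inside_out_cost (c : nat -> nat -> R) L : (n <= L)%N ->
  (forall r, (r <= L)%N -> c r r = 0) ->
  total_cost L.+1 c (inside_out pi m n) = nested_value c L (pi m) (pi n).
Proof.
move=> nL cZ; have [_ row _] := @inside_out_coupling L.+1 nL.
have -> : total_cost L.+1 c (inside_out pi m n) =
    total_cost L.+1 (forward_cost c L) (inside_out pi m n).
  apply: eq_bigr => p _; apply: eq_bigr => q _; rewrite /forward_cost.
  by case: leqP => // qp; rewrite inside_out_below_diag ?mul0r.
rewrite (total_forward_cost cZ row); congr (_ + _); apply: eq_bigr => a _.
apply: eq_big_nat => b /andP[ab bL].
by rewrite inside_out_mass //; lia.
Qed.

End InsideOut.

(** * Plans as couplings on a common index range *)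

Lemma plan_coupling (R : realType) (pi : nat -> nat -> R) m n M z :
  is_prob_seq pi -> (m < M)%N -> (n < M)%N -> is_plan pi m n z ->
  exists2 z', coupling M (pi m) (pi n) z' &
    forall T, total_cost M T z' = cost T m n z.
Proof.
move=> P mM nM [z0 row col]; have [_ ms _] := P m; have [_ ns _] := P n.
(* [is_plan] says nothing about entries outside its block, so they are reset to 0. *)
pose z' p q := if (p <= m)%N && (q <= n)%N then z p q else 0.
have rowT p (f : nat -> R) : \sum_(0 <= q < M) z' p q * f q =
    if (p <= m)%N then \sum_(q < n.+1) z p q * f q else 0.
  rewrite (@sum_trunc _ _ 0 n.+1 M) //; last first.
    by move=> q nq; rewrite /z' (leqNgt q) nq andbF mul0r.
  rewrite big_mkord /z'; case: ifP => pm; last by rewrite big1 // => q _; rewrite mul0r.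
  by apply: eq_bigr => q _; rewrite (_ : (q <= n)%N) // -ltnS.
exists z'; last first.
  move=> T; rewrite /total_cost; under eq_bigr => p _ do rewrite rowT.
  rewrite (@sum_trunc _ _ 0 m.+1 M) //; last by move=> p mp; rewrite leqNgt mp.
  by rewrite big_mkord; apply: eq_bigr => p _; rewrite -ltnS ltn_ord.
split.
- by move=> p q; rewrite /z'; case: ifP => // /andP[pm qn]; exact: z0.
- move=> p pM; have := rowT p (fun=> 1); under eq_bigr do rewrite mulr1.
  move=> ->; case: (leqP p m) => pm; last by rewrite ms.
  by under eq_bigr do rewrite mulr1; exact: row.
- move=> q qM; rewrite (@sum_trunc _ _ 0 m.+1 M) //; last first.
    by move=> p mp; rewrite /z' leqNgt mp.
  rewrite big_mkord; case: (leqP q n) => qn.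
    rewrite -col //; apply: eq_bigr => p _.
    by rewrite /z' qn andbT -ltnS ltn_ord.
  by rewrite ns // big1 // => p _; rewrite /z' (leqNgt q) qn andbF.
Qed.

Lemma inside_out_plan (R : realType) (pi : nat -> nat -> R) m n :
  is_prob_seq pi -> condH pi -> (m <= n)%N -> is_plan pi m n (inside_out pi m n).
Proof.
move=> P H mn; have [z0 row col] := inside_out_coupling P H mn (ltnSn n).
split=> [i j _ _|i im|j jn]; first exact: z0.
  by rewrite -(row i) ?big_mkord //; lia.
rewrite -(col j) // (@sum_trunc _ _ 0 m.+1 n.+1) ?big_mkord //.
by move=> i mi; exact: inside_out_row_gt.
Qed.

Lemma cost_inside_out (R : realType) (pi T : nat -> nat -> R) m n M :
  (m <= n)%N -> (n < M)%N ->
  cost T m n (inside_out pi m n) = total_cost M T (inside_out pi m n).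
Proof.
move=> mn nM; rewrite /total_cost (@sum_trunc _ _ 0 m.+1 M) //; last 2 first.
- lia.
- by move=> p mp; apply: big1 => q _; rewrite inside_out_row_gt // mul0r.
rewrite big_mkord; apply: eq_bigr => p _.
rewrite (@sum_trunc _ _ 0 n.+1 M) ?big_mkord // => q nq.
by rewrite inside_out_col_gt // mul0r.
Qed.

Lemma product_plan (R : realType) (pi : nat -> nat -> R) m n :
  is_prob_seq pi -> is_plan pi m n (fun i j => pi m i * pi n j).
Proof.
move=> P; have [m0 _ ms] := P m; have [n0 _ ns] := P n.
split=> [i j _ _|i _|j _]; first exact: mulr_ge0.
  by rewrite -mulr_sumr ns mulr1.
by rewrite -mulr_suml ms mul1r.
Qed.

(** * The recursive table and the induction on its size *)

Lemma Dtab_D (R : realType) (pi : nat -> nat -> R) k i j :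
  (i <= k)%N -> Dtab pi k i j = D pi i j.
Proof.
elim: k => [|k IH] ik; first by have -> : i = 0%N by lia.
move: (ik); rewrite leq_eqVlt => /orP[/eqP->//|]; rewrite ltnS => ik' /=.
by rewrite ik' IH.
Qed.

Lemma D0S (R : realType) (pi : nat -> nat -> R) n : D pi 0 n.+1 = 1.
Proof. by []. Qed.

Lemma DS0 (R : realType) (pi : nat -> nat -> R) m : D pi m.+1 0 = 1.
Proof. by rewrite /D /= ltnn. Qed.

Lemma DSS (R : realType) (pi : nat -> nat -> R) m n :
  D pi m.+1 n.+1 =
  inf [set c | exists z, is_plan pi m n z /\ c = cost (D pi) m n z]%classic.
Proof.
rewrite /D /= ltnn; congr inf; apply/seteqP.
have E z : cost (Dtab pi m) m n z = cost (D pi) m n z.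
  apply: eq_bigr => i _; apply: eq_bigr => j _.
  by rewrite Dtab_D // -ltnS.
by split=> c [z [zp ->]]; exists z; rewrite E.
Qed.

(** The induction hypothesis. Below the diagonal no closed form is derived, only the lower bound
    through the last column; the bound by 1 yields that inequality at q = 0, the shifted index
    -1. *)
Definition table_inv (R : realType) (c : nat -> nat -> R) (L : nat) : Prop :=
  [/\ forall i j k l, (i <= j <= k)%N -> (k <= l <= L)%N ->
        c i l + c j k <= c i k + c j l,
      forall r, (r <= L)%N -> c r r = 0,
      forall p q, (q < p <= L)%N -> c p L - c q L <= c p q &
      forall p, (p <= L)%N -> c p L <= 1].

Lemma D_row0_mono (R : realType) (pi : nat -> nat -> R) x : D pi 0 x <= D pi 0 x.+1.
Proof. by case: x => [|x]; rewrite D0S // /D /= ler01. Qed.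

Lemma table_inv_mixed (R : realType) (pi : nat -> nat -> R) L :
  table_inv (D pi) L ->
  forall a b, (a <= b < L)%N -> mixed_diff (D pi) a b <= 0.
Proof.
move=> [Q _ _ _] a b /andP[ab bL]; apply: (@mixed_diff_le0 _ _ L) => // x _.
exact: D_row0_mono.
Qed.

Section TableStep.
Context (R : realType) (pi : nat -> nat -> R) (L : nat).
Hypotheses (P : is_prob_seq pi) (H : condH pi) (I : table_inv (D pi) L).

Lemma nested_value_le_cost m n z : (m <= L)%N -> (n <= L)%N -> is_plan pi m n z ->
  nested_value (D pi) L (pi m) (pi n) <= cost (D pi) m n z.
Proof.
move=> mL nL; case: (I) => Q Z T _.
case/(@plan_coupling _ _ _ _ L.+1 _ P mL nL) => z' zc <-.
by apply: nested_value_le zc => // x _; exact: D_row0_mono.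
Qed.

Lemma cost_inside_outE m n : (m <= n <= L)%N ->
  cost (D pi) m n (inside_out pi m n) = nested_value (D pi) L (pi m) (pi n).
Proof.
case/andP=> mn nL; case: (I) => _ Z _ _.
by rewrite (@cost_inside_out _ _ _ _ _ L.+1) // inside_out_cost.
Qed.

(** Because of the index shift, entries up to [L.+1] are expressed through entries up to [L]. *)
Lemma DSS_nested m n : (m <= n <= L)%N ->
  D pi m.+1 n.+1 = nested_value (D pi) L (pi m) (pi n).
Proof.
move=> /andP[mn nL]; rewrite DSS; apply/eqP; rewrite eq_le; apply/andP; split.
  rewrite -cost_inside_outE ?mn //; apply: ge_inf.
    exists (nested_value (D pi) L (pi m) (pi n)) => c [z [zp ->]].
    by apply: nested_value_le_cost => //; lia.
  by exists (inside_out pi m n); split => //; exact: inside_out_plan.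
apply: lb_le_inf.
  by exists (cost (D pi) m n (inside_out pi m n)), (inside_out pi m n); split => //;
    exact: inside_out_plan.
by move=> c [z [zp ->]]; apply: nested_value_le_cost => //; lia.
Qed.

Let W := table_inv_mixed I.

Let pi_ge0 n p : 0 <= pi n p.
Proof. by have [] := P n. Qed.

Lemma table_inv_step : table_inv (D pi) L.+1.
Proof.
have [Q Z T U] := I.
have U' p : (p <= L.+1)%N -> D pi p L.+1 <= 1.
  (* The new entry is at most an average, under [pi p], of old entries that are at most 1. *)
  case: p => [|p] pL; first by rewrite D0S.
  rewrite DSS_nested; last lia.
  apply: le_trans (nested_value_le_last W (pi_ge0 p) (pi_ge0 L)) _.
  rewrite -(@sum_prob _ pi p L.+1) //; apply: ler_sum_nat => r /andP[_ rL].
  by rewrite -[leRHS]mulr1; apply: ler_wpM2l => //; exact: U.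
split => //.
- move=> i j k l /andP[ij jk] /andP[kl lL].
  case: k => [|k] in jk kl *.
    have [-> ->] : i = 0%N /\ j = 0%N by lia.
    by rewrite addrC lexx.
  case: l => [|l] in kl lL *; first by lia.
  have kL a x : (x <= k)%N ->
      \sum_(a <= p < L.+1) pi x p <= \sum_(a <= p < L.+1) pi k p.
    by move=> xk; apply: tail_mono => //; lia.
  case: i => [|i] in ij *.
    case: j => [|j] in ij jk *; first by rewrite addrC lexx.
    (* Row 0 equals 1 in both columns, so only monotonicity in the target remains; the zero source
       yields it. *)
    have := @nested_value_quadrangle _ pi _ L (fun=> 0) (pi j) k l P H W.
    rewrite !nested_value0 // !add0r -!DSS_nested; try lia.
    rewrite !D0S lerD2l; apply; last lia.
      by move=> a; rewrite big1 // sumr_ge0.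
    by move=> a; exact: kL.
  case: j => [|j] in ij jk *; first by lia.
  rewrite !DSS_nested; try lia.
  apply: (nested_value_quadrangle P H W); last lia.
    by move=> a; apply: tail_mono => //; lia.
  by move=> a; exact: kL.
- case=> [//|r] rL; rewrite DSS_nested; last lia.
  rewrite -cost_inside_outE; last lia.
  (* From [pi r] to itself Inside-Out moves nothing off the diagonal, where the cost is 0. *)
  apply: big1 => i _; apply: big1 => j _; rewrite inside_outE // -ltnS ltn_ord.
  by case: eqP => [->|_]; rewrite ?mul0r // Z ?mulr0 //; have := ltn_ord j; lia.
- case=> [|p] q; first by lia.
  case: q => [|q] /andP[qp pL]; first by rewrite DS0 D0S; have := U' _ pL; lra.
  rewrite [leRHS]DSS; apply: lb_le_inf.
    by exists (cost (D pi) p q (fun i j => pi p i * pi q j)), (fun i j => pi p i * pi q j);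
      split => //; exact: product_plan.
  move=> c [z [zp ->]].
  have pL' : (p < L.+1)%N by [].
  have qL : (q < L.+1)%N by lia.
  have [z' [z0 row col] <-] := plan_coupling P pL' qL zp.
  rewrite !DSS_nested; try lia.
  (* The difference of the two values is bounded by a difference of source terms. Writing both
     through the marginals of the plan makes it the sum of z'(s,r) (D(s,L) - D(r,L)), which is
     compared with the cost entry by entry. *)
  apply: (le_trans (nested_value_leB _ W _)).
    by move=> a; apply: tail_mono => //; lia.
  have -> : \sum_(0 <= s < L.+1) pi q s * D pi s L =
      \sum_(0 <= s < L.+1) \sum_(0 <= r < L.+1) z' s r * D pi r L.
    rewrite exchange_big_nat; apply: eq_big_nat => s /andP[_ sL] /=.
    by rewrite -col // mulr_suml.
  rewrite -sumrB; apply: ler_sum_nat => s /andP[_ sL].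
  rewrite -row // mulr_suml -sumrB; apply: ler_sum_nat => r /andP[_ rL].
  rewrite -mulrBr; apply: ler_wpM2l => //.
  case: (ltnP r s) => rs; first by apply: T; rewrite rs.
  (* Above the diagonal the triangle inequality is the quadrangle inequality with equal middle
     indices. *)
  by have := Q s r r L; rewrite rs leqnn leqnn -ltnS rL (Z r) // => /(_ isT isT); lra.
Qed.

End TableStep.

Lemma table_inv_D (R : realType) (pi : nat -> nat -> R) L :
  is_prob_seq pi -> condH pi -> table_inv (D pi) L.
Proof.
move=> P H; elim: L => [|L IH]; last exact: table_inv_step.
split=> [i j k l ijk kl|r|p q qp|p]; last 1 first.
- by rewrite leqn0 => /eqP->; rewrite /D /= ler01.
- have -> : l = 0%N by lia.
  have -> : k = 0%N by lia.
  have -> : j = 0%N by lia.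
  by have -> : i = 0%N by lia.
- by rewrite leqn0 => /eqP->.
- by lia.
Qed.

Theorem theorem5 (R : realType) (pi : nat -> nat -> R) :
  is_prob_seq pi -> pairwise_distinct pi -> condH pi ->
  (forall i j k l : int, -1 <= i -> i <= j -> j <= k -> k <= l ->
      d pi i l + d pi j k <= d pi i k + d pi j l) /\
  (forall m n : nat, (m <= n)%N ->
      is_plan pi m n (inside_out pi m n) /\
      (forall z, is_plan pi m n z ->
         cost (D pi) m n (inside_out pi m n) <= cost (D pi) m n z)).
Proof.
move=> P _ H; split.
  move=> i j k l i1 ij jk kl; rewrite /d.
  have [Q _ _ _] := table_inv_D (absz (l + 1)) P H.
  by apply: Q; lia.
move=> m n mn; split; first exact: inside_out_plan.
(* Level [n] suffices: the costs entering the sum have shifted indices at most [n]. *)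
move=> z zp; have I := table_inv_D n P H.
rewrite (cost_inside_outE P H I); last by rewrite mn leqnn.
by apply: nested_value_le_cost.
Qed.
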